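(* For every integer $n>2$ there is a nonflexible C-loop $C$ containing an associator of order $n$ (that is, there are $x,y,z\in C$ such that $[x,y,z]$ has order $n$). Moreover, it is possible to have $|C|=4n$ if $n$ is odd, and $|C|=8n$ if $n$ is even.
   Context: A C-loop is a loop satisfying $x(y\cdot yz) = (xy\cdot y)z$. C-loops are inverse property loops and are power-associative, so inverses and orders of elements make sense. A loop is flexible if it satisfies $x\cdot yx = xy\cdot x$, and nonflexible otherwise. The associator of $x,y,z$ is $[x,y,z]=(xy\cdot z)^{-1}\cdot(x\cdot yz)$. *)

(* Defs.v *)
From HB Require Import structures.
From mathcomp Require Import all_boot.

Set Implicit Arguments.
Unset Strict Implicit.
Unset Printing Implicit Defensive.

Local Open Scope group_scope.

(* Loops in equational form; [ldiv_unique] and [rdiv_unique] below give back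
   the unique solvability of a * u = b and u * a = b. *)
HB.mixin Record UMagma_isLoop G of UMagma G := {
  ldiv : G -> G -> G;
  rdiv : G -> G -> G;
  mul_ldiv : forall x y : G, x * ldiv x y = y;
  ldiv_mul : forall x y : G, ldiv x (x * y) = y;
  mul_rdiv : forall x y : G, rdiv x y * y = x;
  rdiv_mul : forall x y : G, rdiv (x * y) y = x
}.

#[short(type="loopType")]
HB.structure Definition Loop := {G of UMagma_isLoop G & UMagma G}.

#[short(type="finLoopType")]
HB.structure Definition FinLoop := {G of Loop G & Finite G}.

Lemma ldiv_unique (G : loopType) (a b : G) : exists! u, a * u = b.
Proof. by exists (ldiv a b); split=> [|u <-]; rewrite ?mul_ldiv ?ldiv_mul. Qed.

Lemma rdiv_unique (G : loopType) (a b : G) : exists! u, u * a = b.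
Proof. by exists (rdiv b a); split=> [|u <-]; rewrite ?mul_rdiv ?rdiv_mul. Qed.

Definition C_loop (G : loopType) : Prop :=
  forall x y z : G, x * (y * (y * z)) = ((x * y) * y) * z.

Definition flexible (G : loopType) : Prop :=
  forall x y : G, x * (y * x) = (x * y) * x.

(* The right inverse, which in a C-loop is also the left inverse, and has the
   inverse property (see [C_loop_mulVK] and [C_loop_mulKV]). *)
Definition loop_inv (G : loopType) (x : G) : G := ldiv x 1.

Lemma loop_mulV (G : loopType) (x : G) : x * loop_inv x = 1.
Proof. exact: mul_ldiv. Qed.

Lemma C_loop_mulVK (G : loopType) (x y : G) :
  C_loop G -> loop_inv x * (x * y) = y.
Proof.
move=> CG; have rK w : rdiv 1 x * (x * w) = w.
  by rewrite -[w in LHS](mul_ldiv x) CG mul_rdiv mul1g mul_ldiv.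
by rewrite -[in LHS](rK (loop_inv x)) loop_mulV mulg1 rK.
Qed.

Lemma C_loop_mulV (G : loopType) (x : G) : C_loop G -> loop_inv x * x = 1.
Proof. by move=> CG; rewrite -[x in _ * x]mulg1 C_loop_mulVK. Qed.

Lemma C_loop_mulKV (G : loopType) (x y : G) :
  C_loop G -> (y * x) * loop_inv x = y.
Proof.
by move=> CG; rewrite -[y in LHS](mul_rdiv y x) -CG loop_mulV mulg1 mul_rdiv.
Qed.

Definition associator (G : loopType) (x y z : G) : G :=
  loop_inv ((x * y) * z) * (x * (y * z)).

(* [a ^+ k] is the right-bracketed power a * (a * (... * a)); C-loops are
   power-associative, so the bracketing is immaterial there. *)
Definition has_order (G : loopType) (a : G) (n : nat) : Prop :=
  [/\ (0 < n)%N, a ^+ n = 1 & forall m : nat, (0 < m < n)%N -> a ^+ m <> 1].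

(* Main.v *)
(** Let V = {1, u, v, w} be the Klein four-group and A an abelian group.  For a
    map mu : V * V -> A normalised by mu(1, g) = mu(g, 1) = 0, the central
    extension V x A with product (g, s)(h, t) = (gh, s + t + mu(g, h)) is a
    loop, and since V has exponent 2 it is a C-loop iff
    mu(y, z) + mu(y, yz) = mu(x, y) + mu(xy, y) for all x, y, z.
    Fix a in A and let mu(g, h) = a, except that mu(g, h) = 0 when g = 1, h = 1
    or (g, h) is one of (u, v), (v, w), (w, u).  Then both sides are a if y <> 1
    and 0 if y = 1, while the associator of u, v, u is the central element 2a.
    It has order n for a a generator of Z/n with n odd, or of Z/2n. *)
Require Import Defs.
From HB Require Import structures.
From mathcomp Require Import all_boot all_algebra zify.

Set Implicit Arguments.
Unset Strict Implicit.
Unset Printing Implicit Defensive.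

Import GRing.Theory.
Local Open Scope ring_scope.

(* V is encoded as bool * bool under componentwise [addb], with
   u = (true, false), v = (false, true) and w = (true, true). *)
Notation klein := (bool * bool)%type.

Definition klein_add (g h : klein) : klein := (g.1 (+) h.1, g.2 (+) h.2).

(* The automorphism u -> v -> w -> u. *)
Definition klein_rot (g : klein) : klein := (g.2, g.1 (+) g.2).

Definition cocycle (g h : klein) : bool :=
  [&& g != (false, false), h != (false, false) & h != klein_rot g].

(** Indexing the type by [a] lets it carry a product that depends on [a]. *)
Definition klein_ext (A : finZmodType) (a : A) : Type := (klein * A)%type.

Section KleinExtension.

Variables (A : finZmodType) (a : A).
Local Notation L := (klein_ext a).

HB.instance Definition _ := Finite.on L.

Definition kext_one : L := ((false, false), 0).

Definition kext_mul (x y : L) : L :=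
  (klein_add x.1 y.1, x.2 + y.2 + a *+ cocycle x.1 y.1).

(** As V has exponent 2, a quotient in V is a product. *)
Definition kext_ldiv (x y : L) : L :=
  let g := klein_add x.1 y.1 in (g, y.2 - x.2 - a *+ cocycle x.1 g).

Definition kext_rdiv (y x : L) : L :=
  let g := klein_add x.1 y.1 in (g, y.2 - x.2 - a *+ cocycle g x.1).

Lemma klein_addA : associative klein_add.
Proof. by move=> [? ?] [? ?] [? ?]; rewrite /klein_add /= !addbA. Qed.

Lemma klein_addC : commutative klein_add.
Proof. by move=> [? ?] [? ?]; rewrite /klein_add /= addbC [in X in (_, X)]addbC. Qed.

Lemma klein_addKb g : cancel (klein_add g) (klein_add g).
Proof. by move: g => [? ?] [? ?]; rewrite /klein_add /= !addKb. Qed.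

Lemma kext_1mul : left_id kext_one kext_mul.
Proof. by move=> [[g1 g2] s]; rewrite /kext_mul /= add0r addr0. Qed.

Lemma kext_mul1 : right_id kext_one kext_mul.
Proof.
by move=> [[g1 g2] s]; rewrite /kext_mul /klein_add /cocycle /= !addbF andbF !addr0.
Qed.

Lemma kext_mul_ldiv x y : kext_mul x (kext_ldiv x y) = y.
Proof.
case: x y => [g s] [h t]; rewrite /kext_mul /= klein_addKb; congr (_, _).
by rewrite addrA [s + _]addrC !subrK.
Qed.

Lemma kext_ldiv_mul x y : kext_ldiv x (kext_mul x y) = y.
Proof.
case: x y => [g s] [h t]; rewrite /kext_ldiv /= klein_addKb; congr (_, _).
by rewrite addrAC addrK addrC addKr.
Qed.

Lemma kext_mul_rdiv x y : kext_mul (kext_rdiv x y) y = x.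
Proof.
case: x y => [g s] [h t]; rewrite /kext_mul /= klein_addC klein_addKb.
by congr (_, _); rewrite addrAC !subrK.
Qed.

Lemma kext_rdiv_mul x y : kext_rdiv (kext_mul x y) y = x.
Proof.
case: x y => [g s] [h t]; rewrite /kext_rdiv /= [klein_add g h]klein_addC.
by rewrite klein_addKb addrAC addrK addrK.
Qed.

HB.instance Definition _ := hasMul.Build L kext_mul.
HB.instance Definition _ := Magma_isUMagma.Build L kext_1mul kext_mul1.
HB.instance Definition _ := UMagma_isLoop.Build L
  kext_mul_ldiv kext_ldiv_mul kext_mul_rdiv kext_rdiv_mul.

Lemma kext_mulE (x y : L) : (x * y)%g = kext_mul x y.
Proof. by []. Qed.

(** For h nontrivial, [cocycle h] vanishes exactly on 1 and [klein_rot h], a transversal of {1, h},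
    so exactly one of k, hk contributes 1. On the right the transversal consists of 1 and the
    preimage of h under [klein_rot]. *)
Lemma cocycleD g h k :
  (cocycle h k + cocycle h (klein_add h k)
   = cocycle g h + cocycle (klein_add g h) h)%N.
Proof. by move: g h k => [[] []] [[] []] [[] []]. Qed.

Lemma klein_ext_C_loop : C_loop L.
Proof.
move=> [g s] [h t] [k r].
rewrite !kext_mulE /kext_mul /= klein_addKb
  -[klein_add (klein_add g h) h]klein_addA.
have -> : klein_add h h = (false, false) by case: h => [[] []].
have -> : klein_add g (false, false) = g by case: g => [[] []].
congr (_, _ + _).
have := congr1 (fun i => a *+ i) (cocycleD g h k); rewrite !mulrnDr => E.
rewrite -!addrA; congr (_ + (_ + _)).
rewrite [RHS]addrCA; congr (_ + _).
by rewrite E addrC addrA.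
Qed.

Definition kext_u : L := ((true, false), 0).
Definition kext_v : L := ((false, true), 0).

(** This bracketing meets only the exceptional pairs (u, v) and (w, u); the other meets (v, u) and
    (u, w), each adding [a]. *)
Lemma kext_uvu_l : (kext_u * kext_v * kext_u)%g = ((false, true), 0) :> L.
Proof. by rewrite !kext_mulE /kext_mul /= !addr0. Qed.

Lemma kext_uvu_r : (kext_u * (kext_v * kext_u))%g = ((false, true), a *+ 2) :> L.
Proof. by rewrite !kext_mulE /kext_mul /= !addr0 !add0r. Qed.

Lemma kext_not_flexible : a *+ 2 != 0 -> ~ flexible L.
Proof.
by move=> a2 /(_ kext_u kext_v); rewrite kext_uvu_l kext_uvu_r => -[/eqP/(negP a2)].
Qed.

Lemma kext_associator :
  associator kext_u kext_v kext_u = ((false, false), a *+ 2) :> L.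
Proof.
rewrite /associator kext_uvu_l kext_uvu_r /loop_inv.
rewrite /mul /= /kext_mul /ldiv /= /kext_ldiv /=.
by congr (_, _); rewrite /one /= subr0 add0r addrAC addNr add0r.
Qed.

(** The fibre over 1 is a copy of A, since the cocycle vanishes there. *)
Lemma kext_expg (b : A) m :
  ((((false, false), b) : L) ^+ m)%g = ((false, false), b *+ m).
Proof.
elim: m => [|m IHm] //; rewrite expgS IHm.
by rewrite !kext_mulE /kext_mul /= addr0 mulrS.
Qed.

Lemma kext_has_order (b : A) n :
  (0 < n)%N -> (forall m, (b *+ m == 0) = (n %| m)%N) ->
  has_order (((false, false), b) : L) n.
Proof.
move=> n0 bE; split=> // [|m /andP[m0 mn]]; rewrite kext_expg.
  by congr (_, _); apply/eqP; rewrite bE.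
by case=> /eqP; rewrite bE => /(dvdn_leq m0); rewrite leqNgt mn.
Qed.

Lemma card_klein_ext : #|{: L}| = (4 * #|A|)%N.
Proof. by rewrite !card_prod card_bool. Qed.

End KleinExtension.

Lemma Zp_mul2rn_eq0 (p : nat) (m : nat) :
  (1 < p)%N -> ((1 : 'Z_p) *+ 2 *+ m == 0) = (p %| 2 * m)%N.
Proof.
by move=> p1; rewrite -mulrnA -(inj_eq val_inj) /= val_Zp_nat // /dvdn.
Qed.

Local Close Scope ring_scope.

Theorem corollary5p12 (n : nat) (hn : 2 < n) :
  exists C : finLoopType,
    [/\ C_loop C,
        ~ flexible C,
        exists x y z : C, has_order (associator x y z) n
      & #|C| = if odd n then 4 * n else 8 * n].
Proof.
pose p := (if odd n then n else 2 * n)%N.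
have p1 : (1 < p)%N by rewrite /p; case: odd; lia.
have dvdp m : ((1 : 'Z_p) *+ 2 *+ m == 0)%R = (n %| m)%N.
  rewrite Zp_mul2rn_eq0 // /p; case: ifP => on; last by rewrite dvdn_pmul2l.
  by rewrite Gauss_dvdr // coprimen2.
exists (klein_ext (1%R : 'Z_p)); split.
- exact: klein_ext_C_loop.
(* By [dvdp] at m = 1, 2a = 0 would force n to divide 1. *)
- apply: kext_not_flexible; rewrite -[(_ *+ 2)%R]mulr1n dvdp dvdn1; lia.
- exists (kext_u _), (kext_v _), (kext_u _); rewrite kext_associator.
  by apply: kext_has_order dvdp; lia.
- by rewrite card_klein_ext card_ord Zp_cast // /p; case: odd; lia.
Qed.
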